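(* Let $\mathcal{E}$ be an evolution algebra over $\mathbb{K}$. If $\mathcal{E}$ is $\phi$-free, then the following hold: (i) $\operatorname{BNil}(\mathcal{E})=\operatorname{ann}(\mathcal{E})$; and (ii) if $\operatorname{SNil}(\mathcal{E})^2$ is an ideal of $\mathcal{E}$, then $\operatorname{SNil}(\mathcal{E})=\operatorname{Asoc}_1(\mathcal{E})$.
   Context: $\mathbb{K}$ is a field of characteristic different from $2$. An evolution algebra over $\mathbb{K}$ is a finite-dimensional $\mathbb{K}$-algebra (commutative, not necessarily associative) having a basis $B=\{e_1,\dots,e_n\}$, called a natural basis, with $e_ie_j=0$ for $i\neq j$. $\operatorname{ann}(\mathcal{E})=\{u: u\mathcal{E}=0\}$. For an algebra $\mathcal{A}$ put $\mathcal{A}^1=\mathcal{A}$, $\mathcal{A}^{m+1}=\sum_{i=1}^m\mathcal{A}^i\mathcal{A}^{m+1-i}$ (products of subspaces are linear spans of products); $\mathcal{A}$ is nilpotent if $\mathcal{A}^m=0$ for some $m$; an ideal is nilpotent if it is so as an algebra; an ideal $I$ is abelian if $I^2=0$. A basic ideal (relative to $B$) is an ideal spanned by a subset of $B$. The basic nilradical $\operatorname{BNil}(\mathcal{E})$ is the largest nilpotent basic ideal of $\mathcal{E}$; equivalently $\operatorname{BNil}(\mathcal{E})=\operatorname{ann}^r(\mathcal{E})$, where $\operatorname{ann}^1(\mathcal{E})=\operatorname{ann}(\mathcal{E})$, $\operatorname{ann}^i(\mathcal{E})/\operatorname{ann}^{i-1}(\mathcal{E})=\operatorname{ann}(\mathcal{E}/\operatorname{ann}^{i-1}(\mathcal{E}))$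 for $i\ge2$, and $r$ is the step at which this ascending series stabilises. An ideal $I$ of $\mathcal{E}$ is $\mathcal{E}$-supersolvable if there is a chain $0=I_0\subsetneq I_1\subsetneq\dots\subsetneq I_s=I$ with each $I_i$ an ideal of $\mathcal{E}$ and $\dim I_i=i$. The supersolvable nilradical $\operatorname{SNil}(\mathcal{E})$ is the largest $\mathcal{E}$-supersolvable nilpotent ideal of $\mathcal{E}$ (a largest such ideal exists). $\operatorname{Asoc}_1(\mathcal{E})$ is the sum of all one-dimensional abelian ideals of $\mathcal{E}$. The Frattini subalgebra $F(\mathcal{E})$ is the intersection of all maximal subalgebras of $\mathcal{E}$; the Frattini ideal $\phi(\mathcal{E})$ is the largest ideal of $\mathcal{E}$ contained in $F(\mathcal{E})$; $\mathcal{E}$ is $\phi$-free if $\phi(\mathcal{E})=0$. *)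

(* Defs.v *)
From mathcomp Require Export all_boot all_algebra.
From mathcomp Require Export boolp classical_sets.

Set Implicit Arguments.
Unset Strict Implicit.
Unset Printing Implicit Defensive.

Import GRing.Theory.
Local Open Scope ring_scope.
Local Open Scope classical_set_scope.

(* A (not necessarily associative) finite-dimensional algebra over K is a
   vectType E with a bilinear product mul : {bilinear E -> E -> E}.            *)

Section Largest.
Variables (K : fieldType) (E : vectType K).
Implicit Types (P : {vspace E} -> Prop) (U V : {vspace E}).

Definition is_largest P U : Prop := P U /\ forall V, P V -> (V <= U)%VS.

(* The value 0 is only a default for the case where no largest subspace
   satisfies P; it does not occur for phi, BNil and SNil below, in an algebra
   with a natural basis.                                                      *)
Definition largest P : {vspace E} := xget 0%VS [set U | is_largest P U].

Lemma largestP P : (exists U, is_largest P U) -> is_largest P (largest P).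
Proof. by move=> exU; apply: (@xgetPex _ _ [set U | is_largest P U]). Qed.

Lemma largest_eq P U : is_largest P U -> largest P = U.
Proof.
move=> lU; have [PL leL] := largestP (ex_intro _ U lU); have [PU leU] := lU.
by apply/eqP; rewrite eqEsubv leL ?leU.
Qed.

End Largest.

Section Algebra.
Variables (K : fieldType) (E : vectType K) (mul : {bilinear E -> E -> E}).
Implicit Types (U V I M : {vspace E}) (B : seq E).

Definition mulv U V : {vspace E} :=
  <<[seq mul u v | u <- vbasis U, v <- vbasis V]>>%VS.

Lemma memv_mulv U V u v : u \in U -> v \in V -> mul u v \in mulv U V.
Proof.
move=> /coord_vbasis-> /coord_vbasis->.
rewrite linear_sumlz; apply: memv_suml => i _.
rewrite linear_sumr; apply: memv_suml => j _.
rewrite linearZl_LR linearZr_LR !memvZ // memv_span //.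
by apply/allpairsP; exists ((vbasis U)`_i, (vbasis V)`_j); rewrite !memt_nth.
Qed.

Lemma mulvP U V I :
  reflect {in U & V, forall u v, mul u v \in I} (mulv U V <= I)%VS.
Proof.
apply: (iffP idP) => [sUVI u v Uu Vv | sUVI].
  by rewrite (subvP sUVI) ?memv_mulv.
apply/span_subvP=> _ /allpairsP[[u v] /= [Uu Vv ->]].
by rewrite sUVI ?vbasis_mem.
Qed.

Definition subalgebra U : Prop := {in U &, forall u v, mul u v \in U}.

Definition ideal I : Prop :=
  forall x u, u \in I -> mul x u \in I /\ mul u x \in I.

Definition ann : set E := [set u | forall x, mul u x = 0 /\ mul x u = 0].

(* powers_seq U m = [:: U^1; ...; U^(m.+1)]                                   *)
Fixpoint powers_seq U (m : nat) : seq {vspace E} :=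
  if m is m'.+1 then
    let p := powers_seq U m' in
    rcons p (\sum_(i < m) mulv (nth 0 p i) (nth 0 p (m' - i)))%VS
  else [:: U].

(* Powers are indexed from 1; powv U 0 is also U.                             *)
Definition powv U m : {vspace E} := nth 0%VS (powers_seq U m.-1) m.-1.

Lemma powv1 U : powv U 1 = U. Proof. by []. Qed.

Lemma size_powers_seq U m : size (powers_seq U m) = m.+1.
Proof. by elim: m => //= m IHm; rewrite size_rcons IHm. Qed.

Lemma nth_powers_seq U m i :
  (i <= m)%N -> nth 0%VS (powers_seq U m) i = powv U i.+1.
Proof.
elim: m => [|m IHm]; first by case: i.
rewrite leq_eqVlt => /predU1P[-> // | lt_i_m].
by rewrite /= nth_rcons size_powers_seq lt_i_m IHm.
Qed.

Lemma powvS U m : (0 < m)%N ->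
  powv U m.+1 = (\sum_(1 <= i < m.+1) mulv (powv U i) (powv U (m.+1 - i)))%VS.
Proof.
case: m => // m _; rewrite {1}/powv [m.+2.-1]/= [powers_seq _ _]/=.
rewrite nth_rcons size_powers_seq ltnn eqxx big_add1 big_mkord.
apply: eq_bigr => i _; have le_i_m : (i <= m)%N by rewrite -ltnS.
by rewrite !nth_powers_seq ?leq_subr // subSS subSn.
Qed.

Definition nilpotent U : Prop := exists m, powv U m = 0%VS.

Definition abelian I : Prop := mulv I I = 0%VS.

Definition natural_basis B : Prop :=
  basis_of fullv B /\ {in B &, forall x y, x != y -> mul x y = 0}.

Definition basic B I : Prop :=
  exists2 s : seq E, {subset s <= B} & I = <<s>>%VS.

Definition BNil B : {vspace E} :=
  largest (fun I => [/\ ideal I, basic B I & nilpotent I]).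

Definition supersolvable I : Prop :=
  exists (s : nat) (c : nat -> {vspace E}),
    [/\ c 0%N = 0%VS, c s = I,
        forall i, (i <= s)%N -> ideal (c i) /\ \dim (c i) = i
      & forall i, (i < s)%N -> (c i <= c i.+1)%VS /\ c i <> c i.+1].

Definition SNil : {vspace E} :=
  largest (fun I => [/\ ideal I, supersolvable I & nilpotent I]).

(* A sum of a possibly infinite family: the union of its finite subsums.      *)
Definition Asoc1 : set E :=
  [set x | exists2 s : seq {vspace E},
     forall I, I \in s -> [/\ ideal I, \dim I = 1%N & abelian I]
     & x \in (\sum_(I <- s) I)%VS].

Definition maximal_subalgebra M : Prop :=
  [/\ subalgebra M, M <> fullv
    & forall U, subalgebra U -> (M <= U)%VS -> U = M \/ U = fullv].

Definition Frattini : set E :=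
  \bigcap_(M in [set M | maximal_subalgebra M]) [set` M].

Definition phi : {vspace E} :=
  largest (fun I => ideal I /\ [set` I] `<=` Frattini).

Definition phi_free : Prop := phi = 0%VS.

End Algebra.

(* Main.v *)
(* Two facts about arbitrary commutative algebras carry the proof. If I is a
   nilpotent ideal and I^2 is an ideal, then I^2 lies in every maximal
   subalgebra M: otherwise M + I^2 = E, so I = (I `&` M) + I^2, and nilpotency
   forces I `&` M = I. If E is phi-free and S is an abelian ideal, then S has a
   complementary subalgebra C. Part (i) is the first fact, since the square of
   a basic ideal is always an ideal. In part (ii) the first fact makes
   N = SNil(E) abelian; taking for S the sum of the one-dimensional abelian
   ideals, N `&` C is an ideal which, if nonzero, would contain a
   one-dimensional ideal, as N is supersolvable; hence N = S.
   SNil(E) is a genuine maximum because a nilpotent ideal J of E multiplies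
   every one-dimensional factor V / W of ideals of E to zero: its elements act
   on V / W by scalars, V * J lies in J, and J acts nilpotently on J. *)
Require Import Defs.

Set Implicit Arguments.
Unset Strict Implicit.
Unset Printing Implicit Defensive.

Import GRing.Theory.
Local Open Scope ring_scope.
Local Open Scope classical_set_scope.

(** * Subspaces of extremal dimension *)

Section Subspaces.
Variables (K : fieldType) (E : vectType K).
Implicit Types (P : {vspace E} -> Prop) (U V W : {vspace E}).

(** A member of greatest dimension is already largest. The witness [W] need not contain [U] or [V],
    so [P] need not be known to be closed under sums. *)
Lemma exists_largest P U0 : P U0 ->
    (forall U V, P U -> P V -> ~~ (V <= U)%VS ->
       exists2 W, P W & (\dim U < \dim W)%N) ->
  exists U, is_largest P U.
Proof.
move=> PU0 grow.
have exd : exists n, `[< exists2 U, P U & \dim U = n >].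
  by exists (\dim U0); apply/asboolP; exists U0.
have led n : `[< exists2 U, P U & \dim U = n >] -> (n <= \dim {:E})%N.
  by move=> /asboolP[U _ <-]; apply/dimvS/subvf.
case: (ex_maxnP exd led) => n /asboolP[U PU dimU] maxn.
exists U; split=> // V PV; apply/negPn/negP => nVU.
have [W PW] := grow _ _ PU PV nVU.
by rewrite ltnNge dimU maxn //; apply/asboolP; exists W.
Qed.

Lemma exists_largest_addv P : P 0%VS ->
  (forall U V, P U -> P V -> P (U + V)%VS) -> exists U, is_largest P U.
Proof.
move=> P0 PD; apply: (exists_largest P0) => U V PU PV nVU.
exists (U + V)%VS; first exact: PD.
rewrite ltn_neqAle dimvS ?addvSl // andbT.
apply: contra nVU; rewrite (dimv_leqif_eq (addvSl U V)) => /eqP ->.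
exact: addvSr.
Qed.

Lemma exists_min_dimv P U0 : P U0 ->
  exists2 U, P U & forall V, P V -> (V <= U)%VS -> V = U.
Proof.
move=> PU0.
have exd : exists n, `[< exists2 U, P U & \dim U = n >].
  by exists (\dim U0); apply/asboolP; exists U0.
case: (ex_minnP exd) => n /asboolP[U PU dimU] minn.
exists U => // V PV sVU; apply/eqP; rewrite eqEdim sVU dimU minn //.
by apply/asboolP; exists V.
Qed.

Lemma subv_big_sum (T : Type) (r : seq T) (Q : pred T) (F : T -> {vspace E}) V :
    (forall i, Q i -> (F i <= V)%VS) -> (\sum_(i <- r | Q i) F i <= V)%VS.
Proof.
move=> sFV; apply: (big_ind (fun U => U <= V)%VS) => // [|U W sUV sWV].
  exact: sub0v.
by rewrite subv_add sUV.
Qed.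

Lemma addv_line_codim1 W V v : (W <= V)%VS -> \dim V = (\dim W).+1 ->
  v \in V -> v \notin W -> V = (W + <[v]>)%VS.
Proof.
move=> sWV dimV Vv nWv; apply/esym/eqP.
have sWvV : (W + <[v]> <= V)%VS by rewrite subv_add sWV -memvE.
rewrite eqEdim sWvV dimV ltn_neqAle dimvS ?addvSl // andbT.
apply: contra nWv; rewrite (dimv_leqif_eq (addvSl _ _)) => /eqP ->.
exact: subvP (addvSr _ _) _ (memv_line v).
Qed.

End Subspaces.

Section CommutativeAlgebra.
Variables (K : fieldType) (E : vectType K) (mul : {bilinear E -> E -> E}).
Hypothesis mulC : commutative mul.
Implicit Types (U V W I J M N C D : {vspace E}).

(** * Ideals and subalgebras *)

Lemma idealC I : (forall x u, u \in I -> mul x u \in I) -> ideal mul I.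
Proof. by move=> idI x u Iu; rewrite (mulC u) idI. Qed.

Lemma ideal0 : ideal mul 0%VS.
Proof.
by apply: idealC => x u; rewrite memv0 => /eqP ->; rewrite linear0r mem0v.
Qed.

Lemma ideal_add I J : ideal mul I -> ideal mul J -> ideal mul (I + J)%VS.
Proof.
move=> idI idJ; apply: idealC => x _ /memv_addP[u Iu [v Jv ->]].
by rewrite linearDr memv_add ?(proj1 (idI _ _ _)) ?(proj1 (idJ _ _ _)).
Qed.

Lemma ideal_cap I J : ideal mul I -> ideal mul J -> ideal mul (I :&: J)%VS.
Proof.
move=> idI idJ; apply: idealC => x u; rewrite !memv_cap => /andP[Iu Ju].
by rewrite (proj1 (idI _ _ Iu)) (proj1 (idJ _ _ Ju)).
Qed.

Lemma ideal_subalgebra I : ideal mul I -> subalgebra mul I.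
Proof. by move=> idI u v _ Iv; case: (idI u v Iv). Qed.

Lemma subalgebra_cap U V :
  subalgebra mul U -> subalgebra mul V -> subalgebra mul (U :&: V)%VS.
Proof.
move=> sU sV u v; rewrite !memv_cap => /andP[Uu Vu] /andP[Uv Vv].
by rewrite sU ?sV.
Qed.

Lemma subalgebra_add_ideal I M :
  ideal mul I -> subalgebra mul M -> subalgebra mul (I + M)%VS.
Proof.
move=> idI sM _ _ /memv_addP[u Iu [v Mv ->]] /memv_addP[u' Iu' [v' Mv' ->]].
have -> : mul (u + v) (u' + v') = mul u (u' + v') + mul v u' + mul v v'.
  by rewrite linearDl (linearDr _ v) /= addrA.
rewrite memv_add ?sM // memvD //; first by case: (idI (u' + v') u Iu).
by case: (idI v u' Iu').
Qed.

Lemma mulv_sub_ideal U I : ideal mul I -> (mulv mul U I <= I)%VS.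
Proof. by move=> idI; apply/mulvP => u v _ Iv; case: (idI u v Iv). Qed.

(** * Powers and nilpotency *)

Lemma powv_mul_sub U k :
  (0 < k)%N -> (mulv mul U (powv mul U k) <= powv mul U k.+1)%VS.
Proof.
by move=> k_gt0; rewrite powvS // big_ltn // powv1 subn1; apply: addvSl.
Qed.

Lemma mem_powvS U k u v : u \in U -> v \in powv mul U k.+1 ->
  mul u v \in powv mul U k.+2.
Proof.
by move=> Uu Uv; apply/(subvP (powv_mul_sub U (ltn0Sn k)))/memv_mulv.
Qed.

(** The square of a nilpotent ideal consists of non-generators: if [I] lies in [U + I^(k+1)],
    expanding products of two elements of [I] puts [I^2], hence [I], in [U + I^(k+2)], and some
    power of [I] vanishes. *)
Lemma nilpotent_subalgebra_full U I : nilpotent mul I ->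
    subalgebra mul U -> (U <= I)%VS -> (I <= U + mulv mul I I)%VS ->
  (I <= U)%VS.
Proof.
move=> [m Im0] sU sUI sIU2.
suff sIUk k : (I <= U + powv mul I k.+1)%VS.
  by have := sIUk m.-1; rewrite -[powv mul I _]/(powv mul I m) Im0 addv0.
elim: k => [|k IHk]; first by rewrite powv1 addvSr.
apply: (subv_trans sIU2); rewrite subv_add addvSl /=; apply/mulvP => u v Iu Iv.
have /memv_addP[u1 Uu1 [u2 Iu2 defu]] := subvP IHk u Iu.
have /memv_addP[v1 Uv1 [v2 Iv2 defv]] := subvP IHk v Iv.
have -> : mul u v = mul u1 v1 + (mul u1 v2 + mul v u2).
  rewrite addrA -(linearDr _ u1) -defv (mulC v) defu linearDl //.
apply: memv_add; first exact: sU.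
by rewrite memvD ?mem_powvS // (subvP sUI).
Qed.

(** * Maximal subalgebras and the Frattini ideal *)

Lemma maximal_add_ideal M D : maximal_subalgebra mul M -> ideal mul D ->
  ~~ (D <= M)%VS -> (D + M)%VS = fullv.
Proof.
move=> [sM _ maxM] idD nDM.
have [defM | //] := maxM _ (subalgebra_add_ideal idD sM) (addvSr D M).
by case/negP: nDM; rewrite -defM addvSl.
Qed.

Lemma nilpotent_sqr_sub_maximal I M : ideal mul I -> nilpotent mul I ->
  ideal mul (mulv mul I I) -> maximal_subalgebra mul M -> (mulv mul I I <= M)%VS.
Proof.
move=> idI nilI idI2 maxM; apply/negPn/negP => nI2M; case/negP: (nI2M).
have sI2I : (mulv mul I I <= I)%VS by apply: mulv_sub_ideal.
apply: (subv_trans sI2I); apply: (@subv_trans _ _ (I :&: M)%VS); last first.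
  exact: capvSr.
apply: nilpotent_subalgebra_full => //; last 1 first.
- apply/subvP => u Iu.
  have := memvf u; rewrite -(maximal_add_ideal maxM idI2 nI2M).
  case/memv_addP=> d I2d [w Mw defu]; rewrite defu addrC memv_add //.
  rewrite memv_cap Mw andbT.
  by rewrite -[w](addKr d) -defu addrC memvB ?(subvP sI2I d I2d).
- by apply: subalgebra_cap; [apply: ideal_subalgebra | case: maxM].
- exact: capvSl.
Qed.

Lemma phi_free_ideal D : phi_free mul -> ideal mul D ->
  (forall M, maximal_subalgebra mul M -> (D <= M)%VS) -> D = 0%VS.
Proof.
pose P I := ideal mul I /\ [set` I] `<=` Frattini mul.
have PE I : ideal mul I ->
    (forall M, maximal_subalgebra mul M -> (I <= M)%VS) -> P I.
  by move=> idI sIM; split=> // x Ix M maxM; apply: (subvP (sIM M maxM)).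
have sPM I M : P I -> maximal_subalgebra mul M -> (I <= M)%VS.
  by move=> [_ sIF] maxM; apply/subvP => x Ix; apply: (sIF x Ix M).
(* [largest] defaults to 0, so [phi0] says something only once a largest element is known to
   exist. *)
have exP : exists I, is_largest P I.
  apply: exists_largest_addv => [|I J PI PJ].
    by apply: PE => [|M _]; [apply: ideal0 | apply: sub0v].
  apply: PE => [|M maxM]; last by rewrite subv_add !sPM.
  by apply: ideal_add; [case: PI | case: PJ].
move=> phi0 idD sDM; have [_ /(_ D (PE D idD sDM))] := largestP exP.
by rewrite -[largest P]/(phi mul) phi0 subv0 => /eqP.
Qed.

Lemma phi_free_nilpotent_abelian I : phi_free mul -> ideal mul I ->
  nilpotent mul I -> ideal mul (mulv mul I I) -> abelian mul I.
Proof.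
move=> phi0 idI nilI idI2; apply: phi_free_ideal => // M.
exact: nilpotent_sqr_sub_maximal.
Qed.

Lemma abelianP I : abelian mul I <-> {in I &, forall u v, mul u v = 0}.
Proof.
split=> [abI u v Iu Iv | I0].
  by apply/eqP; rewrite -memv0 -abI memv_mulv.
apply/eqP; rewrite -subv0; apply/mulvP => u v Iu Iv; rewrite I0 //.
exact: mem0v.
Qed.

Lemma abelian_nilpotent I : abelian mul I -> nilpotent mul I.
Proof. by exists 2; rewrite powvS // big_ltn // big_geq // addv0. Qed.

(** [C] is a subalgebra of least dimension with [I + C = E]. Then [I :&: C] is an ideal contained in
    every maximal subalgebra, hence zero. *)
Lemma phi_free_complement I : phi_free mul -> ideal mul I -> abelian mul I ->
  exists C, [/\ subalgebra mul C, (I + C)%VS = fullv & (I :&: C)%VS = 0%VS].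
Proof.
move=> phi0 idI /abelianP abI.
have [|C [sC defE] minC] := @exists_min_dimv _ _
  (fun C => subalgebra mul C /\ (I + C)%VS = fullv) fullv.
  by split=> [u v _ _|]; rewrite ?memvf // addvf.
exists C; split=> //.
(* In [x = y + z] the part [y] in [I] kills [u] because [I] is abelian, and [z] keeps [u] inside
   [C]. *)
have idIC : ideal mul (I :&: C)%VS.
  apply: idealC => x u ICu; have [Iu Cu] : u \in I /\ u \in C.
    by apply/andP; rewrite -memv_cap.
  have := memvf x; rewrite -defE => /memv_addP[y Iy [z Cz ->]].
  rewrite linearDl /= (abI y u) // add0r memv_cap sC // andbT.
  by case: (idI z u Iu).
apply: (phi_free_ideal phi0 idIC) => M maxM; apply/negPn/negP => nICM.
have defE' := maximal_add_ideal maxM idIC nICM.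
have [sM _ _] := maxM.
(* By the modular law [C = (I :&: C) + (C :&: M)], so [C :&: M] also supplements [I]; minimality
   then forces [C] into [M]. *)
have /minC : subalgebra mul (C :&: M)%VS /\ (I + (C :&: M))%VS = fullv.
  split; first exact: subalgebra_cap.
  apply/eqP; rewrite eqEsubv subvf /= -{1}defE.
  rewrite subv_add addvSl /=; apply/subvP => c Cc.
  have := memvf c; rewrite -defE' => /memv_addP[d].
  rewrite memv_cap => /andP[Id Cd] [w Mw defc].
  rewrite defc memv_add // memv_cap Mw andbT.
  by rewrite -[w](addKr d) -defc addrC memvB.
move=> /(_ (capvSl _ _)) defC; case/negP: nICM.
by rewrite -defC capvA capvSr.
Qed.

(** * Nilpotent ideals acting on chains of ideals *)

Lemma nilpotent_act_codim1 I W V : nilpotent mul I -> ideal mul I ->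
    ideal mul W -> ideal mul V -> (W <= V)%VS -> \dim V = (\dim W).+1 ->
  {in I & V, forall x v, mul x v \in W}.
Proof.
move=> [m Im0] idI idW idV sWV dimV x v1 Ix Vv1; apply/negPn/negP => nWxv1.
have nWv1 : v1 \notin W by apply: contra nWxv1 => Wv1; case: (idW x v1 Wv1).
(* The vector [v] spans [V] modulo [W] and also lies in [I], so its iterates under [x] run down the
   powers of [I]. *)
set v := mul x v1 in nWxv1.
have Vv : v \in V by case: (idV x v1 Vv1).
have Iv : v \in I by case: (idI v1 x Ix).
have : v1 \in V by [].
rewrite (addv_line_codim1 sWV dimV Vv nWxv1) => /memv_addP[w Ww [_ /vlineP[a ->]]].
move=> defv1.
(* The operator x acts on the line V / W by a scalar, whose inverse is a. *)
have aiter n : v - a ^+ n *: iter n (mul x) v \in W.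
  elim: n => [|n IHn]; first by rewrite expr0 scale1r subrr mem0v.
  have -> : v - a ^+ n.+1 *: iter n.+1 (mul x) v =
      mul x w + a *: mul x (v - a ^+ n *: iter n (mul x) v).
    rewrite linearBr scalerBr linearZr_LR /= scalerA -exprS addrA; congr (_ - _).
    by rewrite -linearZr_LR -linearDr -defv1.
  by rewrite memvD ?memvZ //; [case: (idW x w Ww) | case: (idW x _ IHn)].
have iter_pow n : iter n (mul x) v \in powv mul I n.+1.
  by elim: n => [|n IHn]; [rewrite powv1 | apply: mem_powvS].
have := iter_pow m.-1; rewrite -[powv mul I _]/(powv mul I m) Im0 memv0.
move=> /eqP itv0; have := aiter m.-1; rewrite itv0 scaler0 subr0.
exact/negP.
Qed.

Lemma powv_sub I m : ideal mul I -> (powv mul I m <= I)%VS.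
Proof.
move=> idI; elim/ltn_ind: m => [[|[|m]]] IHm; rewrite ?subvv //.
rewrite powvS // big_nat; apply: subv_big_sum => i /andP[i_gt0 _].
apply/mulvP => u v _ iv; suff Iv : v \in I by case: (idI u v Iv).
by apply: subvP iv; rewrite IHm // ltn_subrL i_gt0.
Qed.

(** Without associativity, a product of degree at least [2 ^ k.+1] still has a factor of degree at
    least [2 ^ k]. Each doubling of the degree thus descends one step of the flag, and [2 ^ s]
    reaches zero. *)
Lemma nilpotent_of_flag I (s : nat) (c : nat -> {vspace E}) :
    ideal mul I -> c 0%N = 0%VS -> c s = I ->
    (forall i, (i < s)%N -> {in I & c i.+1, forall x v, mul x v \in c i}) ->
  nilpotent mul I.
Proof.
move=> idI c0 cs cS.
have sub_powv k m : (2 ^ k <= m)%N -> (powv mul I m <= c (s - k)%N)%VS.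
  elim: k m => [|k IHk] m; first by rewrite subn0 cs powv_sub.
  rewrite expnS mul2n => le_m.
  have m_gt1 : (1 < m)%N.
    by apply: leq_trans le_m; rewrite (leq_double 1) expn_gt0.
  case: m m_gt1 le_m => // m m_gt0 le_m; rewrite powvS // big_nat.
  apply: subv_big_sum => i /andP[i_gt0 le_im].
  (* Subtraction is truncated: for [k >= s] both indices are 0, and [c 0 = 0] settles the claim. *)
  have mulIc u v : u \in I -> v \in c (s - k)%N -> mul u v \in c (s - k.+1)%N.
    move=> Iu cv; have [lt_ks | le_sk] := ltnP k s; last first.
      move: cv; rewrite (eqnP le_sk) c0 memv0 => /eqP ->.
      by rewrite linear0r mem0v.
    by apply: cS; rewrite ?subnSK ?leq_subr.
  apply/mulvP => u v iu iv.
  have Iu : u \in I by apply: subvP iu; apply: powv_sub.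
  have Iv : v \in I by apply: subvP iv; apply: powv_sub.
  have [le_ki | lt_ik] := leqP (2 ^ k) i.
    by rewrite mulC mulIc // (subvP (IHk i le_ki)).
  rewrite mulIc // (subvP (IHk _ _) v iv) // leq_subRL 1?ltnW //.
  by apply: leq_trans le_m; rewrite -addnn ltn_add2r.
exists (2 ^ s)%N; apply/eqP; rewrite -subv0.
by have := sub_powv s _ (leqnn _); rewrite subnn c0.
Qed.

(** * The supersolvable nilradical *)

Definition ssn_ideal I := [/\ ideal mul I, supersolvable mul I & nilpotent mul I].

(** Adding to [I] the first term of the chain of [J] not contained in [I] raises the dimension by
    exactly one, so the sum [L] extends the chain of [I] by one step. *)
Lemma ssn_ideal_grow I J : ssn_ideal I -> ssn_ideal J -> ~~ (J <= I)%VS ->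
  exists2 L, ssn_ideal L & (\dim I < \dim L)%N.
Proof.
move=> [idI [s [c [c0 cs cid cle]]] nilI] [idJ [t [d [d0 dt did dle]]] nilJ] nJI.
have exj : exists j, (j <= t)%N && ~~ (d j <= I)%VS.
  by exists t; rewrite leqnn dt.
case: (ex_minnP exj) => [[|j]]; first by rewrite d0 sub0v andbF.
case/andP=> lt_jt ndI minj.
have dI : (d j <= I)%VS.
  apply/negPn/negP => ndj; have := minj j; rewrite ndj ltnW // ltnn.
  by move/(_ isT).
have sdJ : (d j.+1 <= J)%VS.
  have sdt n i : (i + n)%N = t -> (d i <= d t)%VS.
    elim: n i => [|n IHn] i; first by rewrite addn0 => ->.
    rewrite addnS -addSn => def_t; apply: subv_trans (IHn _ def_t).
    by case: (dle i _); rewrite // -def_t ltn_addr.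
  by rewrite -dt (sdt (t - j.+1)%N) // subnKC.
have [idd dimd] := did _ lt_jt; have [_ dimdj] := did _ (ltnW lt_jt).
have [v dv nIv] : exists2 v, v \in d j.+1 & v \notin I by apply/subvPn.
have defd : d j.+1 = (d j + <[v]>)%VS.
  apply: addv_line_codim1 => //; first by case: (dle _ lt_jt).
    by rewrite dimd dimdj.
  by apply: contra nIv; apply: (subvP dI).
pose L := (I + d j.+1)%VS.
have idL : ideal mul L by apply: ideal_add.
have [_ dimI] := cid s (leqnn s); rewrite cs in dimI.
have ltIL : (\dim I < \dim L)%N.
  rewrite ltn_neqAle dimvS ?addvSl // andbT.
  by apply: contra ndI; rewrite (dimv_leqif_eq (addvSl _ _)) => /eqP ->; apply: addvSr.
have dimL : \dim L = s.+1.
  apply/eqP; rewrite eqn_leq -{2}dimI ltIL andbT.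
  have -> : L = (I + <[v]>)%VS by rewrite /L defd addvA (addv_idPl dI).
  apply: leq_trans (dimv_add_leqif _ _) _.
  by rewrite dimI -addn1 leq_add2l dim_vline; case: (v != 0).
pose c' i := if (i <= s)%N then c i else L.
have c'id i : (i <= s.+1)%N -> ideal mul (c' i) /\ \dim (c' i) = i.
  rewrite /c' leq_eqVlt ltnS; case: leqP => [le_is _ | lt_si]; first exact: cid.
  by rewrite orbF => /eqP ->.
have c'le i : (i < s.+1)%N -> (c' i <= c' i.+1)%VS.
  rewrite /c' ltnS => le_is; rewrite le_is; case: ltnP => [/cle[] // | le_si].
  have -> : i = s by apply/eqP; rewrite eqn_leq le_is.
  by rewrite cs addvSl.
have c's : c' s.+1 = L by rewrite /c' ltnn.
exists L => //; split=> //.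
  exists s.+1, c'; split=> // i lt_is; split; first exact: c'le.
  move=> /(congr1 (@dimv _ _)); rewrite (proj2 (c'id _ lt_is)).
  by rewrite (proj2 (c'id _ (ltnW lt_is))) => /n_Sn.
apply: (nilpotent_of_flag idL _ c's) => [|i lt_is _ v' /memv_addP[x Ix [y dy ->]] cv'].
  by rewrite /c' c0.
have [idW dimW] := c'id _ (ltnW lt_is); have [idV dimV] := c'id _ lt_is.
(* Both [I] and [J] kill every factor of the chain [c'], hence so does [L], which lies in
   [I + J]. *)
have act N : nilpotent mul N -> ideal mul N ->
    {in N & c' i.+1, forall x v, mul x v \in c' i}.
  move=> nilN idN; apply: nilpotent_act_codim1 => //; first exact: c'le.
  by rewrite dimV dimW.
rewrite linearDl memvD //; first exact: (act I).
by apply: (act J) => //; apply: (subvP sdJ).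
Qed.

Lemma zero_ssn_ideal : ssn_ideal 0%VS.
Proof.
split; [exact: ideal0 | | by exists 1%N].
exists 0%N, (fun=> 0%VS); split=> // i; rewrite leqn0 => /eqP ->.
by split; [apply: ideal0 | rewrite dimv0].
Qed.

Lemma SNil_largest : is_largest ssn_ideal (SNil mul).
Proof. exact/largestP/(exists_largest zero_ssn_ideal)/ssn_ideal_grow. Qed.

Lemma line_ssn_ideal I : ideal mul I -> \dim I = 1%N -> abelian mul I ->
  ssn_ideal I.
Proof.
move=> idI dimI abI; split=> //; last exact: abelian_nilpotent.
exists 1%N, (fun i => if i is 0 then 0%VS else I); split=> //.
  by move=> [|[|//]] _; rewrite ?dimv0 //; split=> //; apply: ideal0.
move=> [|//] _; split; first exact: sub0v.
by move=> I0; rewrite -I0 dimv0 in dimI.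
Qed.

(** The first nonzero [D :&: c j.+1] meets [c j] trivially, and [c j] has codimension one in
    [c j.+1]; so this intersection is a line. *)
Lemma supersolvable_line I D : supersolvable mul I -> ideal mul D ->
  (D <= I)%VS -> D <> 0%VS ->
  exists L, [/\ ideal mul L, \dim L = 1%N & (L <= D)%VS].
Proof.
move=> [s [c [c0 cs cid cle]]] idD sDI nD0.
have exj : exists j, (j <= s)%N && (D :&: c j != 0)%VS.
  by exists s; rewrite leqnn cs (capv_idPl sDI); apply/eqP.
case: (ex_minnP exj) => [[|j]]; first by rewrite c0 capv0 eqxx andbF.
case/andP=> lt_js nDc minj; exists (D :&: c j.+1)%VS.
have [idc dimc] := cid _ lt_js; have [_ dimcj] := cid _ (ltnW lt_js).
split; [exact: ideal_cap | | exact: capvSl].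
apply/eqP; rewrite eqn_leq lt0n dimv_eq0 nDc andbT.
have Dcj : (D :&: c j = 0)%VS.
  apply/eqP/negPn/negP => ndj; have := minj j; rewrite ndj ltnW // ltnn.
  by move/(_ isT).
have := dimvS (_ : (D :&: c j.+1 + c j <= c j.+1)%VS).
have [sc _] := cle _ lt_js.
rewrite subv_add capvSr sc dimv_disjoint_sum; last first.
  by rewrite -capvA (capv_idPr sc).
by rewrite dimc dimcj -add1n leq_add2r; apply.
Qed.

Lemma phi_free_SNil : phi_free mul ->
  ideal mul (mulv mul (SNil mul) (SNil mul)) -> [set` SNil mul] = Asoc1 mul.
Proof.
move=> phi0 idN2; have [[idN ssN nilN] maxN] := SNil_largest.
set N := SNil mul in idN ssN nilN maxN idN2 *.
have abN := phi_free_nilpotent_abelian phi0 idN nilN idN2.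
pose line I := [/\ ideal mul I, \dim I = 1%N & abelian mul I].
(* Finite sums of lines are closed under addition, so finite dimension makes one of them, [S], the
   whole of [Asoc1]. *)
pose P U := exists2 s : seq {vspace E}, forall I, I \in s -> line I
  & U = (\sum_(I <- s) I)%VS.
have exP : exists U, is_largest P U.
  apply: exists_largest_addv => [|_ _ [s1 l1 ->] [s2 l2 ->]].
    by exists [::]; rewrite ?big_nil.
  exists (s1 ++ s2); last by rewrite big_cat.
  by move=> I; rewrite mem_cat => /orP[/l1 | /l2].
have [S [[s lines defS] maxS]] := exP.
have sSN : (S <= N)%VS.
  rewrite defS big_seq; apply: subv_big_sum => I /lines[idI dimI abI].
  exact/maxN/line_ssn_ideal.
have idS : ideal mul S.
  rewrite defS big_seq; apply: big_ind => [||I /lines[]//].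
    exact: ideal0.
  exact: ideal_add.
have abS : abelian mul S.
  apply/abelianP => u v Su Sv.
  by rewrite (proj1 (abelianP N) abN) // (subvP sSN).
have [C [sC defE SC0]] := phi_free_complement phi0 idS abS.
have idNC : ideal mul (N :&: C)%VS.
  apply: idealC => x u; rewrite !memv_cap => /andP[Nu Cu].
  have := memvf x; rewrite -defE => /memv_addP[y Sy [z Cz ->]].
  have Ny := subvP sSN y Sy.
  rewrite linearDl /= (proj1 (abelianP N) abN y u Ny Nu) add0r.
  by rewrite sC // andbT; case: (idN z u Nu).
have NC0 : (N :&: C = 0)%VS.
  apply/eqP/negPn/negP => /eqP nNC.
  have [L [idL dimL sLNC]] := supersolvable_line ssN idNC (capvSl _ _) nNC.
  have [sLN sLC] : (L <= N)%VS /\ (L <= C)%VS by apply/andP; rewrite -subv_cap.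
  have : P L.
    exists [:: L]; rewrite ?big_seq1 // => I; rewrite inE => /eqP ->.
    split=> //; apply/abelianP => u v Lu Lv.
    by rewrite (proj1 (abelianP N) abN) // (subvP sLN).
  move=> /maxS sLS; have : (L <= S :&: C)%VS by rewrite subv_cap sLS.
  by rewrite SC0 subv0 => /eqP L0; rewrite L0 dimv0 in dimL.
(* The modular law gives [N = S + (N :&: C)], as [S] lies in [N]. *)
have defN : N = S.
  apply/eqP; rewrite eqEsubv sSN andbT; apply/subvP => x Nx.
  have := memvf x; rewrite -defE => /memv_addP[y Sy [z Cz defx]].
  suff /eqP z0 : z == 0 by rewrite defx z0 addr0.
  rewrite -memv0 -NC0 memv_cap Cz andbT.
  by rewrite -[z](addKr y) -defx addrC memvB // (subvP sSN).
rewrite defN; apply/seteqP; split=> x /=; first by exists s; rewrite -?defS.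
by case=> r linesr xr; apply: subvP xr; apply: maxS; exists r.
Qed.

(** * Basic ideals and the basic nilradical *)

(** A basis vector in [s] multiplies [I^2], a part of [I], into [I^2]; one outside [s] annihilates
    [I] by orthogonality. *)
Lemma basic_sqr_ideal B I : natural_basis mul B -> basic B I -> ideal mul I ->
  ideal mul (mulv mul I I).
Proof.
move=> [basB orthB] [s sB defI] idI.
apply: idealC => x u I2u; have Iu : u \in I.
  by apply: subvP I2u; apply: mulv_sub_ideal.
have : x \in <<B>>%VS by rewrite (span_basis basB) memvf.
rewrite -[B]in_tupleE => /coord_span ->.
rewrite linear_sumlz; apply: memv_suml => i _.
rewrite linearZl_LR memvZ //; set b := _`_i.
have Bb : b \in B by apply: mem_nth.
have [sb | nsb] := boolP (b \in s).
  by rewrite memv_mulv // defI memv_span.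
suff -> : mul b u = 0 by apply: mem0v.
move: Iu; rewrite defI -[s]in_tupleE => /coord_span ->.
rewrite linear_sumr big1 // => j _; rewrite linearZr_LR /= orthB ?scaler0 //.
  by apply: sB; apply: mem_nth.
by apply: contraNneq nsb => ->; apply: mem_nth.
Qed.

(** Both sides equal the span [A] of the basis vectors of square zero. *)
Lemma phi_free_BNil B : phi_free mul -> natural_basis mul B ->
  [set` BNil mul B] = ann mul.
Proof.
move=> phi0 natB; have [basB orthB] := natB.
pose s := [seq e <- B | mul e e == 0]; pose A := <<s>>%VS.
have annb e : e \in B -> mul e e = 0 -> forall x, mul x e = 0.
  move=> Be ee0 x; have : x \in <<B>>%VS by rewrite (span_basis basB) memvf.
  rewrite -[B]in_tupleE => /coord_span ->.
  rewrite linear_sumlz big1 // => i _; rewrite linearZl_LR /=.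
  have [-> | ne] := eqVneq B`_i e; first by rewrite ee0 scaler0.
  by rewrite orthB ?scaler0 // mem_nth.
have A0 x u : u \in A -> mul x u = 0.
  rewrite /A -[s]in_tupleE.
  move=> /coord_span ->; rewrite linear_sumr big1 // => i _.
  have : s`_i \in s by apply: mem_nth.
  rewrite mem_filter linearZr_LR /= => /andP[/eqP ii0 Bi].
  by rewrite annb ?scaler0.
have defA : [set` A] = ann mul.
  apply/seteqP; split=> u /= => [Au x | annu].
    by rewrite mulC A0.
  have : u \in <<B>>%VS by rewrite (span_basis basB) memvf.
  rewrite -[B]in_tupleE => /coord_span defu.
  rewrite defu; apply: memv_suml => i _.
  have [-> | nz] := eqVneq (coord (in_tuple B) i u) 0.
    by rewrite scale0r mem0v.
  have Bi : B`_i \in B by apply: mem_nth.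
  rewrite memvZ // memv_span // mem_filter Bi andbT.
  (* Multiplying [u] by a basis vector isolates one coordinate times the square of that vector. *)
  have [+ _] := annu B`_i; rewrite {1}defu linear_sumlz (bigD1 i) //= big1.
    by rewrite addr0 linearZl_LR => /eqP; rewrite scaler_eq0 (negPf nz).
  move=> j ne_ji; rewrite linearZl_LR /= orthB ?scaler0 ?mem_nth //.
  by rewrite nth_uniq // (free_uniq (basis_free basB)).
suff -> : BNil mul B = A by [].
apply: largest_eq; split.
  split.
  - by apply: idealC => x u Au; rewrite A0 // mem0v.
  - by exists s => // e; rewrite mem_filter => /andP[].
  - by apply: abelian_nilpotent; apply/abelianP => u v _; apply: A0.
move=> I [idI basI nilI].
have idI2 := basic_sqr_ideal natB basI idI.
have /abelianP abI := phi_free_nilpotent_abelian phi0 idI nilI idI2.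
(* Since [I] is abelian, each basis vector spanning it has square zero. *)
have [t tB defI] := basI; rewrite defI; apply/span_subvP => e te.
rewrite memv_span // mem_filter tB // andbT; apply/eqP.
by apply: abI; rewrite defI memv_span.
Qed.

End CommutativeAlgebra.

Theorem theorem4p3 (K : fieldType) (charK : 2%N \notin [pchar K])
    (E : vectType K) (mul : {bilinear E -> E -> E}) (mulC : commutative mul)
    (B : seq E) (natB : natural_basis mul B) (phi0 : phi_free mul) :
  [set` BNil mul B] = ann mul /\
  (ideal mul (mulv mul (SNil mul) (SNil mul)) ->
   [set` SNil mul] = Asoc1 mul).
Proof. by split; [apply: phi_free_BNil | apply: phi_free_SNil]. Qed.
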